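(* Let $K$ be a field of characteristic $p>0$ such that $K/K^{p^\infty}$ is a finitely generated field extension, where $K^{p^\infty}=\bigcap_{n\ge 0}K^{p^n}$. There is a bijection between power towers on $K$ and Jacobson sequences on $K$, given by $W_\bullet\mapsto(T_{W_0/W_1},T_{W_1/W_2},\ldots)$ with inverse $(\mathcal{F}_1,\mathcal{F}_2,\ldots)\mapsto(W_n)_{n\ge0}$, $W_0=K$, $W_n=\operatorname{Ann}(\mathcal{F}_n)$ for $n\ge1$. For every integer $n\ge 0$ this bijection restricts to a bijection between power towers of length at most $n$ and Jacobson sequences of length at most $n$. Moreover, for $m\ge 1$, $\dim_{W_m}(W_{m-1})=p^{\dim_{W_{m-1}}(\mathcal{F}_m)}$.
   Context: A power tower on $K$ is a sequence of subfields $W_0,W_1,\ldots$ of $K$ with $W_j=W_i\cdot K^{p^j}$ whenever $j\le i$ ($\cdot$ = compositum in $K$); it has length at most $n$ if $W_N=W_n$ for all $N\ge n$. For a field $F$ of characteristic $p$, $TF$ is the space of derivations of $F$ and $T_{F/A}$ the derivations vanishing on a subfield $A$. A $p$-Lie algebra on $F$ is an $F$-subspace of $TF$ closed under commutators and $p$-th powers (of composition); $\operatorname{Ann}(L)=\{x\in F:D(x)=0\ \forall D\in L\}$. A Jacobson sequence on $K$ is a sequence $(\mathcal{F}_1,\mathcal{F}_2,\ldots)$ where $\mathcal{F}_1$ is a $p$-Lie algebra on $K$ and $\mathcal{F}_{i+1}$ is a $p$-Lie algebra on $\operatorname{Ann}(\mathcal{F}_i)$ with $\mathcal{F}_{i+1}\cap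 T_{\operatorname{Ann}(\mathcal{F}_i)/K^{p^i}}=0$; it has length at most $n$ if $\mathcal{F}_N=0$ for all $N>n$. *)

(* Defs.v *)
From mathcomp Require Import all_boot all_algebra.
Set Implicit Arguments. Unset Strict Implicit. Unset Printing Implicit Defensive.
Import GRing.Theory.
Local Open Scope ring_scope.

Section Defs.
Variable K : fieldType.

Definition subfield (F : K -> Prop) : Prop :=
  [/\ F 0, F 1, (forall x y, F x -> F y -> F (x - y)),
      (forall x y, F x -> F y -> F (x * y)) & (forall x, F x -> F x^-1)].

Definition gen_field (S : K -> Prop) : K -> Prop :=
  fun x => forall F, subfield F -> (forall y, S y -> F y) -> F x.

Definition compositum (A B : K -> Prop) : K -> Prop :=
  gen_field (fun y => A y \/ B y).

Definition Kpow (p j : nat) : K -> Prop := fun x => exists y, x = y ^+ (p ^ j).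

Definition Kpinf (p : nat) : K -> Prop := fun x => forall n, Kpow p n x.

Definition fin_gen_over (A : K -> Prop) : Prop :=
  exists s : seq K, forall x, gen_field (fun y => A y \/ y \in s) x.

(* Derivations of the subfield F: a derivation F -> F is represented by a
   function K -> K which maps F into F, is additive and Leibniz on F, and is
   0 outside F (canonical extension, so that equality is extensional). *)
Definition isDer (F : K -> Prop) (D : K -> K) : Prop :=
  [/\ (forall x, ~ F x -> D x = 0),
      (forall x, F x -> F (D x)),
      (forall x y, F x -> F y -> D (x + y) = D x + D y) &
      (forall x y, F x -> F y -> D (x * y) = x * D y + D x * y)].

Definition Tder (F A : K -> Prop) : (K -> K) -> Prop :=
  fun D => isDer F D /\ forall x, A x -> D x = 0.

Definition pLie (p : nat) (F : K -> Prop) (L : (K -> K) -> Prop) : Prop :=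
  (forall D, L D -> isDer F D) /\
  L (fun _ => 0) /\
  (forall D1 D2, L D1 -> L D2 -> L (fun x => D1 x + D2 x)) /\
  (forall c D, F c -> L D -> L (fun x => c * D x)) /\
  (forall D1 D2, L D1 -> L D2 -> L (fun x => D1 (D2 x) - D2 (D1 x))) /\
  (forall D, L D -> L (iter p D)).

Definition Ann (F : K -> Prop) (L : (K -> K) -> Prop) : K -> Prop :=
  fun x => F x /\ forall D, L D -> D x = 0.

Definition power_tower (p : nat) (W : nat -> K -> Prop) : Prop :=
  (forall i, subfield (W i)) /\
  (forall i j, (j <= i)%N -> W j = compositum (W i) (Kpow p j)).

Definition tower_len_le (W : nat -> K -> Prop) (n : nat) : Prop :=
  forall N, (n <= N)%N -> W N = W n.

(* Jacobson sequences, 0-indexed: J n stands for the paper's F_{n+1}. *)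
Fixpoint annseq (J : nat -> (K -> K) -> Prop) (n : nat) : K -> Prop :=
  match n with
  | 0 => fun _ => True
  | m.+1 => Ann (annseq J m) (J m)
  end.

Definition jacobson_seq (p : nat) (J : nat -> (K -> K) -> Prop) : Prop :=
  pLie p (fun _ => True) (J 0) /\
  forall i, pLie p (Ann (annseq J i) (J i)) (J i.+1) /\
    (forall D, J i.+1 D -> Tder (Ann (annseq J i) (J i)) (Kpow p i.+1) D ->
       D = (fun _ => 0)).

(* F_N = 0 for all N > n, i.e. J N = {0} for N >= n *)
Definition jac_len_le (J : nat -> (K -> K) -> Prop) (n : nat) : Prop :=
  forall N, (n <= N)%N -> J N = (fun D => D = (fun _ => 0)).

Definition tower_to_jac (W : nat -> K -> Prop) : nat -> (K -> K) -> Prop :=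
  fun n => Tder (W n) (W n.+1).

Definition jac_to_tower (J : nat -> (K -> K) -> Prop) : nat -> K -> Prop :=
  annseq J.

Definition field_dim (A V : K -> Prop) (n : nat) : Prop :=
  exists b : 'I_n -> K,
    [/\ (forall i, V (b i)),
        (forall c : 'I_n -> K, (forall i, A (c i)) ->
            \sum_i c i * b i = 0 -> forall i, c i = 0) &
        (forall v, V v -> exists c : 'I_n -> K,
            (forall i, A (c i)) /\ v = \sum_i c i * b i)].

Definition der_dim (A : K -> Prop) (L : (K -> K) -> Prop) (n : nat) : Prop :=
  exists b : 'I_n -> (K -> K),
    [/\ (forall i, L (b i)),
        (forall c : 'I_n -> K, (forall i, A (c i)) ->
            (fun x => \sum_i c i * b i x) = (fun _ => 0) -> forall i, c i = 0) &
        (forall D, L D -> exists c : 'I_n -> K,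
            (forall i, A (c i)) /\ D = (fun x => \sum_i c i * b i x))].

End Defs.

(* Main.v *)
Require Import Defs.
From mathcomp Require Import all_boot all_algebra.
From HB Require Import structures.
From mathcomp Require Import boolp ring.
Local Open Scope ring_scope.

Set Implicit Arguments.
Unset Strict Implicit.
Unset Printing Implicit Defensive.
Import GRing.Theory.

(** If D is a derivation with D x = 1 and D^p = 0, then integrating D y
    repeatedly expands every y as a polynomial of degree < p in x over ker D.
    For a p-Lie algebra L on E with annihilator F and [E : F] finite, choose a
    maximal dual system D_i in L, x_i in E with D_i x_j = delta_ij. By
    maximality D = sum_i D(x_i) D_i for all D in L, so the D_i commute and
    satisfy D_i^p = 0 (both sides of these identities agree on the x_j). The
    expansions along x_1, ..., x_r show that the x_i form a p-basis of E over F,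
    which gives [E : F] = p^r and Der(E/F) = L: Jacobson's correspondence.

    Conversely, if E^p <= F <= E and x is in E but not in F, take an
    intermediate field M maximal for not containing x. Then E = M(x), and d/dx
    is a derivation of E over F that does not kill x.

    Since K is finite over each K^(p^n), both facts apply to the successive
    layers of a tower. *)

(** * Subfields given by predicates, turned into field types *)

Section SubfieldType.
Variables (K : fieldType) (M : K -> Prop) (HM : subfield M).

Definition sfield_pred of subfield M : {pred K} := fun x => `[< M x >].

Lemma sfield_pred_divring : GRing.divring_closed (sfield_pred HM).
Proof.
have [_ M1 MB MM MV] := HM; split=> [|x y|x y]; rewrite ?unfold_in /=.
- exact/asboolP.
- by move=> /asboolP Mx /asboolP My; apply/asboolP/MB.
- by move=> /asboolP Mx /asboolP My; apply/asboolP/MM => //; apply: MV.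
Qed.
HB.instance Definition _ := GRing.isDivringClosed.Build K (sfield_pred HM) sfield_pred_divring.

Definition sfield_sub := {x : K | x \in sfield_pred HM}.
HB.instance Definition _ := SubChoice.on sfield_sub.
HB.instance Definition _ := [SubChoice_isSubComUnitRing of sfield_sub by <:].
HB.instance Definition _ := [SubComUnitRing_isSubIntegralDomain of sfield_sub by <:].

HB.instance Definition _ := [SubIntegralDomain_isSubField of sfield_sub by <:].
Definition sfield : fieldType := sfield_sub.

(* Hiding the subtype behind an abstract embedding makes the library's lemmas
   on field morphisms applicable to a Prop-valued subfield. *)
Lemma subfield_embedding :
  exists (F : fieldType) (f : {rmorphism F -> K}),
    (forall y, M (f y)) /\ (forall x, M x -> exists y, f y = x).
Proof.
exists sfield, val; split=> [[x /= /asboolP] // | x Mx].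
by exists (Sub x (introT (asboolP _) Mx)).
Qed.

End SubfieldType.

Section Embedding.
Variables (F K : fieldType) (f : {rmorphism F -> K}) (M : K -> Prop).
Hypothesis Mf : forall x, M x -> exists y, f y = x.

(** Moves polynomials with coefficients in [M] to [F], where division and gcd keep the coefficients
    in the subfield. *)
Lemma polyOver_lift (q : {poly K}) :
  (forall i, M q`_i) -> exists q' : {poly F}, map_poly f q' = q.
Proof.
move=> Mq; have [g gE] := choice (fun i => Mf (Mq i)).
exists (\poly_(i < size q) g i); apply/polyP=> i.
rewrite coef_map coef_poly; case: ltnP => [_|le]; first exact: gE.
by rewrite nth_default //; exact: rmorph0.
Qed.

End Embedding.

(** * Subfields of [K] and simple extensions *)

Section Subfields.
Variable K : fieldType.
Implicit Types (M E F : K -> Prop) (q : {poly K}).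

Definition adjoin M (x y : K) := exists2 q : {poly K}, (forall i, M q`_i) & y = q.[x].

Lemma subfieldD M x y : subfield M -> M x -> M y -> M (x + y).
Proof.
move=> [M0 _ MB _ _] Mx My; rewrite -[y]opprK; apply: (MB) => //.
by rewrite -sub0r; apply: MB.
Qed.

Lemma subfieldN M x : subfield M -> M x -> M (- x).
Proof. by move=> [M0 _ MB _ _] Mx; rewrite -sub0r; apply: MB. Qed.

Lemma subfieldX M x n : subfield M -> M x -> M (x ^+ n).
Proof.
by move=> [_ M1 _ MM _] Mx; elim: n => [|n IH]; rewrite ?expr0 // exprS; apply: MM.
Qed.

Lemma subfield_sum M (I : Type) (r : seq I) (P : pred I) (f : I -> K) :
  subfield M -> (forall i, P i -> M (f i)) -> M (\sum_(i <- r | P i) f i).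
Proof.
move=> HM Mf; elim/big_ind: _ => //; first by case: HM.
by move=> x y; apply: subfieldD.
Qed.

Lemma subfield_nat M n : subfield M -> M n%:R.
Proof.
move=> HM; elim: n => [|n IH]; first by case: HM.
by rewrite -addn1 natrD; apply: subfieldD => //; case: HM.
Qed.

Lemma horner_subfield M q x : subfield M -> (forall i, M q`_i) -> M x -> M q.[x].
Proof.
move=> HM Mq Mx; rewrite horner_coef; apply: subfield_sum => // i _.
by case: (HM) => _ _ _ MM _; apply: MM => //; apply: subfieldX.
Qed.

Lemma adjoin_base M x y : subfield M -> M y -> adjoin M x y.
Proof.
move=> [M0 _ _ _ _] My; exists y%:P; last by rewrite hornerC.
by move=> i; rewrite coefC; case: ifP.
Qed.

Lemma adjoin_gen M x : subfield M -> adjoin M x x.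
Proof.
move=> [M0 M1 _ _ _]; exists 'X; last by rewrite hornerX.
by move=> i; rewrite coefX; case: (_ == _).
Qed.

Lemma adjoin_sub M E x : subfield E -> (forall y, M y -> E y) -> E x ->
  forall y, adjoin M x y -> E y.
Proof. by move=> HE ME Ex y [q Mq ->]; apply: horner_subfield => // i; apply: ME. Qed.

Lemma gen_field_subfield (S : K -> Prop) : subfield (gen_field S).
Proof.
split=> [F [] //|F [] //|x y Gx Gy F HF SF|x y Gx Gy F HF SF|x Gx F HF SF].
- by case: (HF) => _ _ FB _ _; apply: FB; [apply: Gx|apply: Gy].
- by case: (HF) => _ _ _ FM _; apply: FM; [apply: Gx|apply: Gy].
- by case: (HF) => _ _ _ _ FV; apply: FV; apply: Gx.
Qed.

(** Reduction modulo $X^n - x^n$, carried out over [F] so that the remainder still has coefficients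
    in [M]. *)
Lemma adjoin_bounded M x n q : subfield M -> (0 < n)%N -> M (x ^+ n) ->
  (forall i, M q`_i) ->
  exists q' : {poly K}, [/\ (forall i, M q'`_i), (size q' <= n)%N & q'.[x] = q.[x]].
Proof.
move=> HM n0 Mxn Mq; have [F [f [fM Mf]]] := subfield_embedding HM.
have [c cE] := Mf _ Mxn; have [r <-] := polyOver_lift Mf Mq.
pose m := 'X^n - c%:P : {poly F}.
exists (map_poly f (r %% m)); split; first by move=> i; rewrite coef_map; exact: fM.
  rewrite size_map_poly -ltnS.
  by rewrite -(size_XnsubC c n0) ltn_modpN0 // -size_poly_gt0 size_XnsubC.
have mx : (map_poly f m).[x] = 0.
  by rewrite rmorphB /= map_polyXn map_polyC /= cE !hornerE subrr.
by rewrite {2}(divp_eq r m) rmorphD rmorphM /= hornerD hornerM mx mulr0 add0r.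
Qed.

End Subfields.

(** * Calculus of derivations on a subfield *)

Section Derivations.
Variable K : fieldType.
Implicit Types (E F M : K -> Prop) (D : K -> K) (x y : K).

(** Unlike [isDer], no vanishing outside [E] is asked, so the same function can be viewed as a
    derivation of a smaller stable subfield. *)
Definition derOn E D :=
  [/\ forall x, E x -> E (D x),
      forall x y, E x -> E y -> D (x + y) = D x + D y &
      forall x y, E x -> E y -> D (x * y) = x * D y + D x * y].

Lemma isDer_derOn E D : isDer E D -> derOn E D.
Proof. by case. Qed.

Section DerOn.
Variables (E : K -> Prop) (D : K -> K).
Hypotheses (HE : subfield E) (HD : derOn E D).
Let E0 : E 0. Proof. by case: HE. Qed.
Let E1 : E 1. Proof. by case: HE. Qed.
Let EM x y : E x -> E y -> E (x * y). Proof. by case: HE => _ _ _ + _; apply. Qed.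
Let ED x y : E x -> E y -> E (x + y). Proof. exact: subfieldD. Qed.
Let DD x y : E x -> E y -> D (x + y) = D x + D y. Proof. by case: HD => _ + _; apply. Qed.
Let DM x y : E x -> E y -> D (x * y) = x * D y + D x * y. Proof. by case: HD => _ _; apply. Qed.

Lemma der0 : D 0 = 0.
Proof. by have /eqP := DD E0 E0; rewrite addr0 addrC -subr_eq subrr => /eqP. Qed.

Lemma der1 : D 1 = 0.
Proof.
have /eqP := DM E1 E1.
by rewrite !mulr1 mul1r addrC -subr_eq subrr => /eqP.
Qed.

Lemma derN x : E x -> D (- x) = - D x.
Proof.
move=> Ex; apply/eqP; rewrite -addr_eq0 -DD ?addNr ?der0 //.
exact: subfieldN.
Qed.

Lemma derB x y : E x -> E y -> D (x - y) = D x - D y.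
Proof. by move=> Ex Ey; rewrite DD ?derN //; apply: subfieldN. Qed.

Lemma der_sum (I : Type) (r : seq I) (P : pred I) (f : I -> K) :
  (forall i, P i -> E (f i)) ->
  D (\sum_(i <- r | P i) f i) = \sum_(i <- r | P i) D (f i).
Proof.
(* Membership in [E] is carried along, because additivity holds only there. *)
move=> Ef; pose Q a b := E a /\ D a = b.
suff [] : Q (\sum_(i <- r | P i) f i) (\sum_(i <- r | P i) D (f i)) by [].
elim/big_rec2: _ => [|i a b Pi [Eb <-]]; first by split=> //; apply: der0.
by split; [apply: ED; auto | apply: DD; auto].
Qed.

Lemma derX x n : E x -> D (x ^+ n) = x ^+ n.-1 * D x *+ n.
Proof.
move=> Ex; elim: n => [|n IH]; first by rewrite expr0 der1 mulr0n.
rewrite exprS DM ?IH //=; last exact: subfieldX.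
case: n {IH} => [|n]; first by rewrite expr0 mulr0n mulr0 add0r mulr1 mul1r.
by rewrite /= mulrnAr mulrA -exprS (mulrC (D x)) -mulrSr.
Qed.

(** Allows the vanishing of a derivation to be checked on generators. Inverses come from $0 = D(x
    x^{-1}) = x D(x^{-1})$. *)
Lemma der_kernel_subfield : subfield (fun x => E x /\ D x = 0).
Proof.
case: (HE) => _ _ EB _ EV; split=> //.
- by split=> //; apply: der0.
- by split=> //; apply: der1.
- by move=> x y [Ex Dx] [Ey Dy]; split; [apply: EB | rewrite derB // Dx Dy subrr].
- by move=> x y [Ex Dx] [Ey Dy]; split; [apply: EM | rewrite DM // Dx Dy mulr0 mul0r addr0].
move=> x [Ex Dx]; split; first exact: EV.
have [->|x0] := eqVneq x 0; first by rewrite invr0 der0.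
have /eqP := DM Ex (EV _ Ex); rewrite divff // der1 Dx mul0r addr0 eq_sym mulf_eq0.
by rewrite (negPf x0) => /eqP.
Qed.

Lemma der_horner (q : {poly K}) x : E x -> (forall i, E q`_i /\ D q`_i = 0) ->
  D q.[x] = q^`().[x] * D x.
Proof.
move=> Ex; elim/poly_ind: q => [|q c IH] Hq.
  by rewrite deriv0 !horner0 der0 mul0r.
have Hc : E c /\ D c = 0 by have := Hq 0; rewrite coefD coefMX coefC add0r.
have {}Hq i : E q`_i /\ D q`_i = 0.
  by have := Hq i.+1; rewrite coefD coefMX coefC addr0.
have Eq : E q.[x] by apply: horner_subfield => // i; case: (Hq i).
rewrite !hornerE derivD derivM derivC derivX !hornerE DD ?DM ?IH //; last by case: Hc.
  by case: Hc => _ ->; ring.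
exact: EM.
Qed.

(* The Taylor expansion of y at x, obtained by integrating D y. *)
Lemma der_nilpotent_horner p x : p \in [pchar K] -> E x -> D x = 1 ->
  (forall y, E y -> iter p D y = 0) ->
  forall y, E y -> exists q : {poly K},
    [/\ (forall i, E q`_i /\ D q`_i = 0), (size q <= p)%N & y = q.[x]].
Proof.
move=> hp Ex Dx Dp y Ey; have [M0 _ _ MM MV] := der_kernel_subfield.
have : iter p D y = 0 by apply: Dp.
(* Induction on the nilpotency order [n] at [y], with the fixed bound [n <= p] making the integers
   below [n] invertible. *)
have : (p <= p)%N by [].
elim: {1 3 4}p y Ey => [|n IH] y Ey np Dy.
  by exists 0; split=> [i||]; rewrite ?coef0 ?size_poly0 ?horner0.
rewrite iterSr in Dy; have [|q [Hq sq Dyq]] := IH _ _ (ltnW np) Dy.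
  by case: HD => + _ _; apply.
(* The antiderivative of [q]; at [i = 0] the inverse of zero is zero, so the constant term
   vanishes. *)
pose Q := \poly_(i < n.+1) (q`_i.-1 / i%:R).
have HQ i : E Q`_i /\ D Q`_i = 0.
  rewrite coef_poly; case: ifP => // _; apply: MM => //; apply: MV.
  exact: (subfield_nat _ der_kernel_subfield).
have EQ : E Q.[x] by apply: horner_subfield => // i; case: (HQ i).
have dQ : Q^`() = q.
  apply/polyP=> i; rewrite coef_deriv coef_poly ltnS /=.
  case: ltnP => ni; last by rewrite mul0rn nth_default // (leq_trans sq).
  rewrite -[_ *+ _]mulr_natr mulfVK // -(dvdn_pcharf hp) gtnNdvd //.
  exact: leq_ltn_trans np.
(* The constant of integration. *)
have Hy : E (y - Q.[x]) /\ D (y - Q.[x]) = 0.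
  split; first by case: (HE) => _ _ EB _ _; apply: EB.
  by rewrite derB // der_horner // dQ Dx mulr1 Dyq subrr.
exists ((y - Q.[x])%:P + Q); split; last by rewrite !hornerE subrK.
  move=> i; rewrite coefD coefC; case: ifP => _; last by rewrite add0r.
  by split; [apply: ED | rewrite DD]; case: (HQ i); case: Hy => // ? -> ? ->; rewrite ?addr0.
rewrite (leq_trans (size_polyD _ _)) // geq_max size_poly andbT.
exact: leq_trans (size_polyC_leq1 _) _.
Qed.

Lemma iter_derOn n x : E x -> E (iter n D x).
Proof. by move=> Ex; elim: n => //= n; case: HD => + _ _; apply. Qed.

Lemma iter_derD n x y : E x -> E y -> iter n D (x + y) = iter n D x + iter n D y.
Proof. by move=> Ex Ey; elim: n => //= n ->; apply: DD; apply: iter_derOn. Qed.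

Lemma iter_derM n x y : E x -> E y ->
  iter n D (x * y) = \sum_(i < n.+1) iter i D x * iter (n - i) D y *+ 'C(n, i).
Proof.
move=> Ex Ey; elim: n => [|n IH]; first by rewrite big_ord1 bin0 mulr1n.
have Exy i j : E (iter i D x * iter j D y) by apply: EM; apply: iter_derOn.
have EMn a m : E a -> E (a *+ m).
  by move=> Ea; rewrite -mulr_natr; apply: EM => //; apply: subfield_nat.
have DMn a m : E a -> D (a *+ m) = D a *+ m.
  move=> Ea; elim: m => [|m IHm]; first by rewrite !mulr0n der0.
  by rewrite !mulrS DD ?IHm //; apply: EMn.
rewrite iterS IH der_sum => [|i _]; last exact: EMn.
rewrite (eq_bigr (fun i : 'I_n.+1 => iter i D x * iter (n.+1 - i) D y *+ 'C(n, i)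
    + iter i.+1 D x * iter (n - i) D y *+ 'C(n, i))); last first.
  move=> i _; rewrite DMn // DM; [|exact: iter_derOn..].
  by rewrite mulrnDl -iterS -subSn // -ltnS.
rewrite big_split /= big_ord_recl [in RHS]big_ord_recl /= ?subn0 !bin0 -addrA.
congr (_ + _).
under [in RHS]eq_bigr => i _ do rewrite binS mulrnDr.
rewrite [in RHS]big_split /= [in RHS]big_ord_recr /= bin_small // mulr0n addr0.
by congr (_ + _).
Qed.

End DerOn.
End Derivations.

(** * Purely inseparable simple extensions *)

Section PurelyInseparable.
Variables (K : fieldType) (p : nat).
Hypothesis hp : p \in [pchar K].
Implicit Types (E F M : K -> Prop) (D : K -> K) (x y : K).

(** The map $z \mapsto z^n$ is a field endomorphism for such [n]. The lemma reduces statements about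
    [n]-th powers to generators. *)
Lemma subfield_pow_preim M n : subfield M -> [pchar K].-nat n ->
  subfield (fun z => M (z ^+ n)).
Proof.
move=> HM hn; have [M0 M1 MB MM MV] := HM; split.
- by rewrite expr0n; case: eqP.
- by rewrite expr1n.
- move=> x y Mx My; rewrite exprDn_pchar // exprNn_pchar //.
  by apply: MB.
- by move=> x y Mx My; rewrite exprMn; apply: MM.
- by move=> x Mx; rewrite exprVn; apply: MV.
Qed.

Lemma pchar_natX n : [pchar K].-nat (p ^ n)%N.
Proof. by rewrite pnatX pnatE ?hp // (pcharf_prime hp). Qed.

Lemma Kpow_subfield n : subfield (Kpow (K := K) p n).
Proof.
have hn := pchar_natX n; split.
- by exists 0; rewrite expr0n expn_eq0 -leqn0 leqNgt prime_gt0 ?(pcharf_prime hp).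
- by exists 1; rewrite expr1n.
- by move=> _ _ [x ->] [y ->]; exists (x - y); rewrite exprDn_pchar // exprNn_pchar.
- by move=> _ _ [x ->] [y ->]; exists (x * y); rewrite exprMn.
- by move=> _ [x ->]; exists x^-1; rewrite exprVn.
Qed.

(** Every $z$ in $M[x]$ has $z^n$ in $M$, so $z^{-1} = (z^n)^{-1} z^{n-1}$ is again a polynomial in
    $x$. *)
Lemma adjoin_subfield M x n : subfield M -> [pchar K].-nat n -> M (x ^+ n) ->
  subfield (adjoin M x).
Proof.
move=> HM hn Mx; have HA := subfield_pow_preim HM hn.
have [M0 M1 MB MM MV] := HM; have n0 : (0 < n)%N by case/andP: hn.
have AM y z : adjoin M x y -> adjoin M x z -> adjoin M x (y * z).
  move=> [q Mq ->] [r Mr ->]; exists (q * r); last by rewrite hornerM.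
  by move=> i; rewrite coefM; apply: subfield_sum => // j _; apply: MM.
split; first exact: adjoin_base; first exact: adjoin_base.
- move=> _ _ [q Mq ->] [r Mr ->]; exists (q - r); last by rewrite !hornerE.
  by move=> i; rewrite coefB; apply: MB.
- exact: AM.
move=> z Az; have Mz : M (z ^+ n).
  apply: (adjoin_sub HA) Az => // y My; exact: subfieldX.
have [->|z0] := eqVneq z 0; first by rewrite invr0; apply: adjoin_base.
have -> : z^-1 = (z ^+ n)^-1 * z ^+ n.-1.
  by rewrite -{1}(prednK n0) exprS invfM mulfVK // expf_neq0.
apply: (AM); first by apply: adjoin_base => //; apply: MV.
elim: n.-1 => [|m IH]; first by rewrite expr0; apply: adjoin_base.
by rewrite exprS; apply: AM.
Qed.

(** Otherwise the gcd over [M] of [q] and $X^p - x^p = (X - x)^p$ is a scalar multiple of $(X -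
    x)^k$ with $0 < k < p$. Its constant term puts $x^k$ in [M], and since $k$ is prime to $p$, also
    $x$. *)
Lemma power_basis_free M x (q : {poly K}) : subfield M -> ~ M x -> M (x ^+ p) ->
  (forall i, M q`_i) -> (size q <= p)%N -> q.[x] = 0 -> q = 0.
Proof.
move=> HM Mx Mxp Mq; have pr := pcharf_prime hp; have p0 := prime_gt0 pr.
have [F [f [fM Mf]]] := subfield_embedding HM.
have [c cE] := Mf _ Mxp; have [r <-] := polyOver_lift Mf Mq.
rewrite size_map_poly => sr rx; apply: contrapT => r0; apply: Mx.
have {}r0 : r != 0 by apply/eqP=> r0'; apply: r0; rewrite r0' rmorph0.
pose g := gcdp r ('X^p - c%:P).
have mE : map_poly f ('X^p - c%:P) = ('X - x%:P) ^+ p.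
  have hP : [pchar {poly K}].-nat p by rewrite pnatE // pchar_poly.
  rewrite exprDn_pchar // exprNn_pchar // rmorphB /= map_polyXn map_polyC /= cE.
  by rewrite polyC_exp.
have /dvdp_exp_XsubCP [k kp /eqpP[[a b] /= /andP[a0 b0] gE]] :
    map_poly f g %| ('X - x%:P) ^+ p.
  by rewrite -mE dvdp_map dvdp_gcdr.
have gk : size g = k.+1.
  by rewrite -(size_map_poly f) -(size_scale _ a0) gE size_scale // size_exp_XsubC.
have kltp : (k < p)%N.
  by rewrite -gk (leq_trans _ sr) // leq_gcdpl.
have k0 : (0 < k)%N.
  rewrite lt0n; apply/eqP=> k0; move: gE; rewrite k0 expr0 => /(congr1 (horner^~ x)); rewrite !hornerE.
  have : root (map_poly f g) x.
    rewrite gcdp_map root_gcd; apply/andP; split; first by apply/rootP.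
    by rewrite mE; apply/rootP; rewrite !hornerE subrr expr0n eqn0Ngt p0.
  by move/rootP => -> /eqP; rewrite mulr0 eq_sym (negPf b0).
case: (HM) => M0 M1 MB MM MV.
have Mab : M (b / a).
  have := congr1 lead_coef gE; rewrite !lead_coefZ lead_coef_map.
  rewrite (monicP (monic_exp k (monicXsubC x))) mulr1 => <-.
  by rewrite mulrAC divff // mul1r.
(* Evaluation of the gcd at 0 gives $(-x)^k$ up to the scalar [b / a], which lies in [M] by
   comparing leading coefficients. *)
have Mxk : M (x ^+ k).
  have g0 : (map_poly f g).[0] = f g.[0].
    by rewrite -[X in _.[X] = _](rmorph0 f) horner_map.
  have e := congr1 (horner^~ 0) gE; rewrite !hornerE g0 ?add0r exprNn in e.
  have -> : x ^+ k = (-1) ^+ k * ((b / a)^-1 * f g.[0]).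
    by rewrite invf_div mulrAC e mulrAC divff // mul1r signrMK.
  apply: (MM); first by apply: subfieldX => //; apply: subfieldN.
  by apply: (MM); [apply: MV | apply: fM].
(* Bezout: [km * k = kn * p + 1], so $x$ is a quotient of powers of $x^k$ and $x^p$. *)
have [km kn e _] := egcdnP p k0.
have cop : gcdn k p = 1%N.
  by apply/eqP; rewrite -/(coprime k p) coprime_sym prime_coprime // gtnNdvd.
have [->//|x0] := eqVneq x 0.
have -> : x = x ^+ (km * k) / x ^+ (kn * p).
  by rewrite e cop addn1 exprS mulfK // expf_neq0.
by apply: (MM); [|apply: MV]; rewrite mulnC exprM; apply: subfieldX.
Qed.

(** The derivation is $d/dx$. It is well defined because a polynomial over [M] vanishing at [x] is a
    multiple of $X^p - x^p$, whose derivative is zero in characteristic [p]. *)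
Lemma adjoin_derivation M x : subfield M -> ~ M x -> M (x ^+ p) ->
  exists D, Tder (adjoin M x) M D /\ D x = 1.
Proof.
move=> HM Mx Mxp; have pr := pcharf_prime hp; have p0 := prime_gt0 pr.
have [M0 M1 MB MM MV] := HM.
have wd0 (q : {poly K}) : (forall i, M q`_i) -> q.[x] = 0 -> q^`().[x] = 0.
  have [F [f [fM Mf]]] := subfield_embedding HM.
  have [c cE] := Mf _ Mxp.
  move=> Mq; have [r <-] := polyOver_lift Mf Mq.
  pose m := 'X^p - c%:P : {poly F}.
  have mE : map_poly f m = 'X^p - (x ^+ p)%:P.
    by rewrite rmorphB /= map_polyXn map_polyC /= cE.
  rewrite (divp_eq r m) rmorphD rmorphM /= mE => qx.
  (* The remainder vanishes at [x] and has degree below [p]. *)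
  have -> : map_poly f (r %% m) = 0.
    apply: (@power_basis_free M x) => //; first by move=> i; rewrite coef_map; apply: fM.
      rewrite size_map_poly -ltnS -(size_XnsubC c p0) ltn_modpN0 //.
      by rewrite -size_poly_gt0 size_XnsubC.
    by move: qx; rewrite !hornerE subrr mulr0 add0r.
  rewrite addr0 derivM derivB derivXn derivC subr0 -mulr_natl.
  by rewrite -polyC_natr (pcharf0 hp) mul0r mulr0 addr0 !hornerE subrr mulr0.
have wd (q r : {poly K}) : (forall i, M q`_i) -> (forall i, M r`_i) ->
    q.[x] = r.[x] -> q^`().[x] = r^`().[x].
  move=> Mq Mr qr; apply/eqP; rewrite -subr_eq0 -hornerN -hornerD -derivN -derivD.
  apply/eqP/wd0; first by move=> i; rewrite coefB; apply: MB.
  by rewrite !hornerE qr subrr.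
(* The value 0 outside $M[x]$ is the convention imposed by [isDer]. *)
have exD y : exists d, (~ adjoin M x y -> d = 0) /\
    forall q : {poly K}, (forall i, M q`_i) -> y = q.[x] -> d = q^`().[x].
  have [[q Mq ->]|nA] := EM (adjoin M x y).
    exists q^`().[x]; split=> [[]|r Mr e]; first by exists q.
    exact: wd.
  by exists 0; split=> // q Mq e; case: nA; exists q.
have [D HD] := choice exD; have D0 y := (HD y).1.
have Dq (q : {poly K}) : (forall i, M q`_i) -> D q.[x] = q^`().[x].
  by move=> Mq; apply: (HD _).2.
have Ddef y (Ay : M y) : D y = 0.
  rewrite -[y](hornerC _ x) Dq ?derivC ?horner0 // => i.
  by rewrite coefC; case: ifP.
exists D; split; last first.
  rewrite -[in LHS](hornerX x) Dq ?derivX ?hornerC // => i.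
  by rewrite coefX; case: (_ == _).
split=> //; split=> //.
- move=> _ [q Mq ->]; rewrite Dq //; exists q^`() => // i.
  rewrite coef_deriv -mulr_natr; apply: MM => //; exact: subfield_nat.
- move=> _ _ [q Mq ->] [r Mr ->]; rewrite -hornerD !Dq ?derivD ?hornerD // => i.
  by rewrite coefD; apply: subfieldD.
move=> _ _ [q Mq ->] [r Mr ->]; rewrite -hornerM !Dq ?derivM ?hornerE //.
  by rewrite addrC.
by move=> i; rewrite coefM; apply: subfield_sum => // j _; apply: MM.
Qed.

End PurelyInseparable.

(** * Spanning families, free families and degrees *)

Section LinearAlgebra.
Variable K : fieldType.
Implicit Types (A E M V : K -> Prop).

Definition spans A V n (b : 'I_n -> K) :=
  forall v, V v -> exists c : 'I_n -> K, (forall i, A (c i)) /\ v = \sum_i c i * b i.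

Definition free_over A n (b : 'I_n -> K) :=
  forall c : 'I_n -> K, (forall i, A (c i)) -> \sum_i c i * b i = 0 ->
    forall i, c i = 0.

(** [mxvec] provides the bijection between pairs of indices and ['I_(m * n)]. *)
Definition prod_family m n (b : 'I_m -> K) (e : 'I_n -> K) : 'I_(m * n) -> K :=
  mxvec (\matrix_(i, j) (b i * e j)) 0.

Lemma sum_prod_family m n (b : 'I_m -> K) (e : 'I_n -> K) (c : 'I_(m * n) -> K) :
  \sum_k c k * prod_family b e k =
  \sum_j (\sum_i c (mxvec_index i j) * b i) * e j.
Proof.
under [RHS]eq_bigr => j _ do rewrite big_distrl.
rewrite exchange_big pair_bigA (reindex _ (curry_mxvec_bij _ _)) /=.
by apply: eq_bigr => [[i j] _] /=; rewrite /prod_family mxvecE mxE mulrA.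
Qed.

Lemma spans_prod A M E m n (b : 'I_m -> K) (e : 'I_n -> K) :
  spans A M b -> spans M E e -> spans A E (prod_family b e).
Proof.
move=> bM eE v /eE [c [Mc ->]].
have [d dE] := choice (fun j => bM _ (Mc j)).
exists (mxvec (\matrix_(i, j) d j i) 0); split.
  by move=> k; case/mxvec_indexP: k => i j; rewrite mxvecE mxE; case: (dE j).
rewrite sum_prod_family; apply: eq_bigr => j _; congr (_ * _).
by rewrite (dE j).2; apply: eq_bigr => i _; rewrite mxvecE mxE.
Qed.

Lemma free_prod A M m n (b : 'I_m -> K) (e : 'I_n -> K) :
  subfield M -> (forall x, A x -> M x) -> (forall i, M (b i)) ->
  free_over A b -> free_over M e -> free_over A (prod_family b e).
Proof.
move=> HM AM Mb fb fe c Ac; rewrite sum_prod_family => /fe ce k.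
case/mxvec_indexP: k => i j; apply: (fb (fun i => c (mxvec_index i j))) => //.
apply: ce => {}j; apply: subfield_sum => // {}i _.
by case: (HM) => _ _ _ MM _; apply: MM => //; apply: AM.
Qed.

Lemma field_dim_mul A M E m n : subfield M -> subfield E ->
  (forall x, A x -> M x) -> (forall x, M x -> E x) ->
  field_dim A M m -> field_dim M E n -> field_dim A E (m * n).
Proof.
move=> HM [_ _ _ EE _] AM ME [b [Mb fb sb]] [e [Ee fe se]].
exists (prod_family b e); split; [|exact: free_prod AM Mb fb fe|exact: spans_prod sb se].
move=> k; case/mxvec_indexP: k => i j; rewrite /prod_family mxvecE mxE.
by apply: EE => //; apply: ME.
Qed.

(** If $m > n$, the $m \times n$ matrix of coordinates of [v] in [b] has a nonzero left kernel, and
    a nonzero row of it is a linear relation among the [v i]. *)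
Lemma free_leq_spans A V n m (b : 'I_n -> K) (v : 'I_m -> K) :
  subfield A -> spans A V b -> (forall i, V (v i)) -> free_over A v -> (m <= n)%N.
Proof.
move=> HA sb Vv fv; rewrite leqNgt; apply/negP=> nm.
have [F [f [fA Af]]] := subfield_embedding HA.
have vE i : exists c : 'I_n -> F, v i = \sum_j f (c j) * b j.
  have [c [Ac ->]] := sb _ (Vv i); have [d dE] := choice (fun j => Af _ (Ac j)).
  by exists d; apply: eq_bigr => j _; rewrite dE.
have [c cE] := choice vE; pose C := \matrix_(i < m, j < n) c i j.
have : kermx C != 0.
  rewrite -mxrank_eq0 mxrank_ker subn_eq0 -ltnNge.
  exact: leq_ltn_trans (rank_leq_col C) nm.
apply/negP/negPn/eqP/row_matrixP=> i; rewrite row0.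
have uC : row i (kermx C) *m C = 0 by rewrite -row_mul mulmx_ker row0.
apply/rowP=> j; rewrite [RHS]mxE; apply: (fmorph_inj f); rewrite rmorph0.
apply: (fv (fun j => f (row i (kermx C) 0 j))) => //.
under eq_bigr => k _ do rewrite cE big_distrr.
rewrite exchange_big big1 //= => l _.
under eq_bigr => k _ do rewrite mulrA -rmorphM.
rewrite -big_distrl -rmorph_sum /=.
have -> : \sum_k row i (kermx C) 0 k * c k l = (row i (kermx C) *m C) 0 l.
  by rewrite [RHS]mxE; apply: eq_bigr => k _; rewrite [C _ _]mxE.
by rewrite uC mxE rmorph0 mul0r.
Qed.

Lemma spans_adjoin M x n : subfield M -> (0 < n)%N -> M (x ^+ n) ->
  spans M (adjoin M x) (fun i : 'I_n => x ^+ i).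
Proof.
move=> HM n0 Mx _ [q Mq ->]; have [r [Mr sr <-]] := adjoin_bounded HM n0 Mx Mq.
by exists (fun i : 'I_n => r`_i); split=> //; apply: horner_coef_wide.
Qed.

Lemma field_dim_refl M : subfield M -> field_dim M M 1.
Proof.
move=> [_ M1 _ _ _]; exists (fun _ => 1); split=> //.
  by move=> c _; rewrite big_ord1 mulr1 => c0 i; rewrite ord1.
by move=> v Mv; exists (fun _ => v); rewrite big_ord1 mulr1.
Qed.

Section Frobenius.
Variable p : nat.
Hypothesis hp : p \in [pchar K].

Lemma field_dim_adjoin M x : subfield M -> ~ M x -> M (x ^+ p) ->
  field_dim M (adjoin M x) p.
Proof.
move=> HM Mx Mxp; have p0 := prime_gt0 (pcharf_prime hp).
exists (fun i : 'I_p => x ^+ i); split; last exact: spans_adjoin.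
  move=> i; apply: subfieldX; last exact: adjoin_gen.
  apply: (adjoin_subfield (n := p)) => //.
  by rewrite pnatE // (pcharf_prime hp).
(* A relation among the powers of [x] is a polynomial of size at most [p] vanishing at [x]. *)
move=> c Mc cx i; have q0 : rVpoly (\row_j c j) = 0.
  apply: (power_basis_free hp HM Mx Mxp); first 2 last.
  - rewrite -[RHS]cx (horner_coef_wide x (size_poly _ _)).
    by apply: eq_bigr => j _; rewrite coef_rVpoly_ord mxE.
  - move=> j; rewrite coef_rVpoly; case: insubP => [k _ _|_]; first by rewrite mxE.
    by case: (HM).
  exact: size_poly.
have := coef_rVpoly_ord (\row_j c j) i.
by rewrite q0 coef0 mxE.
Qed.

(** The generators are adjoined to $K^{p^n}$ one at a time; each has its $p^n$-th power in the base,
    so it multiplies the size of the spanning family by $p^n$. *)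
Lemma fin_gen_spans n : fin_gen_over (Kpinf (K := K) p) ->
  exists N (b : 'I_N -> K), spans (Kpow p n) (fun _ => True) b.
Proof.
move=> [s Hs]; have hn := pchar_natX hp n; have HK := Kpow_subfield hp n.
have [B [HB KB sB [N [b Bb]]]] : exists B, [/\ subfield B,
    (forall x, Kpow p n x -> B x), (forall x, x \in s -> B x) &
    exists N (b : 'I_N -> K), spans (Kpow p n) B b].
  elim: s {Hs} => [|x s [B [HB KB sB [N [b Bb]]]]].
    exists (Kpow p n); split=> //; exists 1%N.
    by have [b [_ _ sb]] := field_dim_refl HK; exists b.
  have Bx : B (x ^+ (p ^ n)) by apply: KB; exists x.
  exists (adjoin B x); split.
  - exact: (adjoin_subfield HB hn Bx).
  - by move=> y /KB By; apply: adjoin_base.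
  - move=> y; rewrite inE => /predU1P[->|/sB By]; first exact: adjoin_gen.
    exact: adjoin_base.
  have n0 : (0 < p ^ n)%N by case/andP: hn.
  by exists (N * p ^ n)%N; eexists; apply: spans_prod Bb (spans_adjoin HB n0 Bx).
exists N, b => x _; apply: Bb; apply: Hs => // y [Ky|]; last exact: sB.
by apply: KB; apply: Ky.
Qed.

End Frobenius.

(** Replaces Zorn's lemma: maximal objects are found by maximizing a bounded numerical rank. *)
Lemma max_nat_prop (P : nat -> Prop) N : (exists n, P n) ->
  (forall n, P n -> (n <= N)%N) -> exists2 n, P n & ~ P n.+1.
Proof.
move=> [n Pn] PN; have ex : exists n, `[< P n >] by exists n; apply/asboolP.
have le m : `[< P m >] -> (m <= N)%N by move/asboolP/PN.
case: (ex_maxnP ex le) => m /asboolP Pm max; exists m => // /asboolP/max.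
by rewrite ltnn.
Qed.

End LinearAlgebra.

(** * p-Lie algebras, separation by derivations, and dual systems *)

Section Jacobson.
Variables (K : fieldType) (p : nat).
Hypothesis hp : p \in [pchar K].
Implicit Types (E F M A : K -> Prop) (L : (K -> K) -> Prop) (D : K -> K).

(** In the Leibniz formula for $D^p$ the inner binomial coefficients are divisible by $p$; hence
    $D^p$ is a derivation. *)
Lemma iter_pchar_derM E D x y : subfield E -> derOn E D -> E x -> E y ->
  iter p D (x * y) = x * iter p D y + iter p D x * y.
Proof.
move=> HE HD Ex Ey; have pr := pcharf_prime hp; have p0 := prime_gt0 pr.
have bp i : (0 < i < p)%N -> 'C(p, i)%:R = 0 :> K.
  by move/(prime_dvd_bin pr); rewrite (dvdn_pcharf hp) => /eqP.
rewrite (iter_derM HE HD) // big_ord_recr binn subnn /= mulr1n; congr (_ + _).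
move: p0 bp; case: (p) => // n _ bp; rewrite big_ord_recl bin0 mulr1n big1 ?addr0 //.
by move=> i _; rewrite -mulr_natr bp ?mulr0 //= /bump /= add1n ltnS.
Qed.

Lemma Tder_pLie E A : subfield E -> pLie p E (Tder E A).
Proof.
move=> HE; have [E0 _ EB EE _] := HE.
have p0 := prime_gt0 (pcharf_prime hp).
split; first by move=> D [].
split; first by split=> //; split=> // *; rewrite ?mulr0 ?mul0r ?addr0.
split.
  move=> D1 D2 [[D10 ED1 DD1 DM1] AD1] [[D20 ED2 DD2 DM2] AD2]; split; last first.
    by move=> x Ax; rewrite AD1 ?AD2 ?addr0.
  split=> [x nx|x Ex|x y Ex Ey|x y Ex Ey].
  - by rewrite D10 ?D20 ?addr0.
  - by apply: subfieldD; auto.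
  - by rewrite DD1 ?DD2 //; ring.
  - by rewrite DM1 ?DM2 //; ring.
split.
  move=> c D Ec [[D0 ED DD DM] AD]; split; last by move=> x Ax; rewrite AD ?mulr0.
  split=> [x nx|x Ex|x y Ex Ey|x y Ex Ey].
  - by rewrite D0 ?mulr0.
  - by apply: EE; auto.
  - by rewrite DD //; ring.
  - by rewrite DM //; ring.
split.
  move=> D1 D2 [HD1 AD1] [HD2 AD2].
  have z1 := der0 HE (isDer_derOn HD1); have z2 := der0 HE (isDer_derOn HD2).
  move: HD1 HD2 => [D10 ED1 DD1 DM1] [D20 ED2 DD2 DM2]; split; last first.
    by move=> x Ax; rewrite (AD1 x) ?(AD2 x) // z1 z2 subrr.
  split=> [x nx|x Ex|x y Ex Ey|x y Ex Ey].
  - by rewrite (D10 x) ?(D20 x) // z1 z2 subrr.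
  - by apply: EB; auto.
  - by rewrite (DD1 x y) // (DD2 x y) // DD1 ?DD2; auto; ring.
  - have e1 := ED1 _ Ex; have e2 := ED2 _ Ex; have f1 := ED1 _ Ey; have f2 := ED2 _ Ey.
    rewrite (DM1 x y) // (DM2 x y) // DD1 ?DD2; try by apply: EE.
    rewrite !DM1 ?DM2 //; ring.
move=> D [HD AD]; have z := der0 HE (isDer_derOn HD).
have it0 n : iter n D 0 = 0 by elim: n => //= n ->.
have itz x : D x = 0 -> iter p D x = 0 by move=> Dx; rewrite -(prednK p0) iterSr Dx it0.
split; last by move=> x Ax; apply/itz/AD.
have HD' := isDer_derOn HD.
split=> [x nx|x Ex|x y Ex Ey|x y Ex Ey].
- by apply: itz; case: HD => + _ _ _; apply.
- exact: iter_derOn.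
- exact: (iter_derD HD').
- exact: (iter_pchar_derM HE HD').
Qed.

Lemma Ann_subfield E L : subfield E -> (forall D, L D -> isDer E D) ->
  subfield (Ann E L).
Proof.
move=> HE LE; have [E0 E1 EB EE EV] := HE.
have HD D : L D -> subfield (fun x => E x /\ D x = 0).
  by move=> LD; apply: der_kernel_subfield => //; apply/isDer_derOn/LE.
split.
- by split=> // D /HD [[_ D0]].
- by split=> // D /HD [_ [_ D1]].
- move=> x y [Ex Dx] [Ey Dy]; split; first exact: EB.
  by move=> D LD; case: (HD D LD) => _ _ H _ _; apply: (H x y _ _).2; auto.
- move=> x y [Ex Dx] [Ey Dy]; split; first exact: EE.
  by move=> D LD; case: (HD D LD) => _ _ _ H _; apply: (H x y _ _).2; auto.
- move=> x [Ex Dx]; split; first exact: EV.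
  by move=> D LD; case: (HD D LD) => _ _ _ _ H; apply: (H x _).2; auto.
Qed.

Definition cons_family n (v : 'I_n -> K) (y : K) (i : 'I_n.+1) :=
  oapp v y (unlift ord0 i).

Lemma free_cons_family A n (v : 'I_n -> K) y : subfield A -> free_over A v ->
  (forall c : 'I_n -> K, (forall i, A (c i)) -> y <> \sum_i c i * v i) ->
  free_over A (cons_family v y).
Proof.
move=> HA fv yv c Ac; rewrite big_ord_recl /cons_family unlift_none /=.
under eq_bigr => i _ do rewrite liftK /=.
have [c0 e|c0] := eqVneq (c ord0) 0.
  rewrite c0 mul0r add0r in e.
  have ce := fv (fun i => c (lift ord0 i)) (fun i => Ac _) e.
  by move=> i; case: (unliftP ord0 i) => [j ->|->].
move=> /eqP; rewrite addr_eq0 => /eqP e; exfalso.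
have [_ _ _ AM AV] := HA.
apply: (yv (fun i => - (c ord0)^-1 * c (lift ord0 i))).
  by move=> i; apply: (AM) => //; apply: subfieldN => //; apply: AV.
under eq_bigr => i _ do rewrite -mulrA.
by rewrite -big_distrr /= mulNr -mulrN -e mulKf.
Qed.

(** The intermediate field [M] avoiding [x] is chosen with the largest number [k] of elements free
    over [F], a number bounded by [N]. Once $E = M[x]$, the derivation $d/dx$ does the job. *)
Lemma Tder_separates E F x N (b : 'I_N -> K) : subfield E -> subfield F ->
  (forall y, F y -> E y) -> (forall y, E y -> F (y ^+ p)) ->
  spans F (fun _ => True) b -> E x -> ~ F x -> exists2 D, Tder E F D & D x = 1.
Proof.
move=> HE HF FE EpF sb Ex Fx; have pr := pcharf_prime hp; have p0 := prime_gt0 pr.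
have pnat : [pchar K].-nat p by rewrite pnatE.
pose P k := exists M, [/\ subfield M, (forall y, F y -> M y), (forall y, M y -> E y),
  ~ M x & exists2 v : 'I_k -> K, (forall i, M (v i)) & free_over F v].
have [||k [M [HM FM ME Mx [v Mv fv]]] max] := @max_nat_prop P N.
- exists 0%N, F; split=> //; exists (fun _ => 0); first by case.
  by move=> c _ _ [].
- by move=> k [M [_ _ _ _ [v _ fv]]]; apply: (free_leq_spans HF sb _ fv).
have EpM y : E y -> M (y ^+ p) by move=> Ey; apply/FM/EpF.
have EA y : E y -> adjoin M x y.
  move=> Ey; apply: contrapT => xy.
  have My : ~ M y by move=> My; apply: xy; apply: adjoin_base.
  have HMy : subfield (adjoin M y) by apply: (adjoin_subfield HM pnat); apply: EpM.
  (* If $M[y]$ still avoids [x], then [y] enlarges the free family, against the choice of [k]. *)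
  have [yx|yx] := EM (adjoin M y x); last first.
    apply: max; exists (adjoin M y); split=> //.
    - by move=> z Fz; apply: adjoin_base => //; apply: FM.
    - exact: adjoin_sub.
    exists (cons_family v y).
      move=> i; rewrite /cons_family; case: unliftP => [j _|_] /=.
        exact: adjoin_base.
      exact: adjoin_gen.
    apply: free_cons_family => // c Fc yE; apply: My; rewrite yE.
    apply: subfield_sum => // i _; case: (HM) => _ _ _ MM _; apply: MM => //.
    exact: FM.
  have sy := spans_adjoin HM p0 (EpM _ Ey).
  have [w [xw fw _]] := field_dim_adjoin hp HM Mx (EpM _ Ex).
  have Axw i : adjoin M y (w i) by apply: (adjoin_sub HMy) (xw i) => // z; apply: adjoin_base.
  (* The [p] elements of a basis of $M[x]$ together with [y] would be free in $M[y]$, which [p]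
     elements span over [M]. *)
  have : free_over M (cons_family w y).
    apply: free_cons_family => // c Mc yE; apply: xy; rewrite yE.
    have HMx : subfield (adjoin M x) by apply: (adjoin_subfield HM pnat); apply: EpM.
    apply: subfield_sum => // i _; case: (HMx) => _ _ _ MM _; apply: MM => //.
    exact: adjoin_base.
  move/(free_leq_spans HM sy); rewrite ltnn; suff: forall i, adjoin M y (cons_family w y i).
    by move=> /[swap] /[apply].
  move=> i; rewrite /cons_family; case: unliftP => [j _|_] //=.
  exact: adjoin_gen.
have EE : E = adjoin M x.
  by apply/funext=> y; apply/propext; split=> [/EA//|]; apply: adjoin_sub.
have [D [[HD MD] Dx]] := adjoin_derivation hp HM Mx (EpM _ Ex).
by exists D => //; rewrite EE; split=> // y /FM /MD.
Qed.

Section pLieClosure.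
Variables (E : K -> Prop) (L : (K -> K) -> Prop).
Hypotheses (HE : subfield E) (HL : pLie p E L).

Lemma pLie_add D1 D2 : L D1 -> L D2 -> L (fun x => D1 x + D2 x).
Proof. by case: HL => _ [_ [+ _]]; apply. Qed.

Lemma pLie_scale c D : E c -> L D -> L (fun x => c * D x).
Proof. by case: HL => _ [_ [_ [+ _]]]; apply. Qed.

Lemma pLie_sum n (c : nat -> K) (D : nat -> K -> K) :
  (forall i, (i < n)%N -> E (c i)) -> (forall i, (i < n)%N -> L (D i)) ->
  L (fun y => \sum_(i < n) c i * D i y).
Proof.
elim: n => [|n IH] Ec LD.
  rewrite (_ : (fun _ => _) = fun _ => 0); first by case: HL => _ [].
  by apply/funext=> y; rewrite big_ord0.
rewrite (_ : (fun _ => _) = fun y => \sum_(i < n) c i * D i y + c n * D n y).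
  apply: pLie_add; first by apply: IH => i ni; [apply: Ec|apply: LD]; apply: ltnW.
  by apply: pLie_scale; [apply: Ec|apply: LD].
by apply/funext=> y; rewrite big_ord_recr.
Qed.

Lemma pLie_addZ c D1 D2 : E c -> L D1 -> L D2 -> L (fun x => D1 x + c * D2 x).
Proof. by move=> Ec L1 L2; apply: pLie_add => //; apply: pLie_scale. Qed.

Lemma pLie_sub_sum D0 n (c : nat -> K) (D : nat -> K -> K) : L D0 ->
  (forall i, (i < n)%N -> E (c i)) -> (forall i, (i < n)%N -> L (D i)) ->
  L (fun y => D0 y - \sum_(i < n) c i * D i y).
Proof.
move=> L0 Ec LD.
rewrite (_ : (fun _ => _) = fun y => D0 y + (-1) * \sum_(i < n) c i * D i y).
  apply: pLie_addZ => //; last exact: pLie_sum.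
  by apply: subfieldN => //; case: HE.
by apply/funext=> y; rewrite mulN1r.
Qed.

Lemma pLie_der D : L D -> isDer E D.
Proof. by case: HL => + _; apply. Qed.

Definition dual_system r (D : nat -> K -> K) (x : nat -> K) :=
  [/\ forall i, (i < r)%N -> L (D i), forall i, (i < r)%N -> E (x i) &
      forall i j, (i < r)%N -> (j < r)%N -> D i (x j) = (i == j)%:R].

(** Applying [D i] to a relation with coefficients in the annihilator isolates the coefficient
    [c i]. This bounds [r] by the size of a spanning family. *)
Lemma dual_system_free r (D : nat -> K -> K) (x : nat -> K) : dual_system r D x ->
  free_over (Ann E L) (fun i : 'I_r => x i).
Proof.
move=> [LD Ex Dx] c Ac cx i; have Hi := isDer_derOn (pLie_der (LD i (ltn_ord i))).
have Ec j : E (c j) by case: (Ac j).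
have EM u v : E u -> E v -> E (u * v) by case: (HE) => _ _ _ + _; apply.
have := congr1 (D i) cx; rewrite (der0 HE Hi) (der_sum HE Hi); last by move=> j _; apply: EM; auto.
rewrite (bigD1 i) //= big1 => [|j ji]; case: (Hi) => _ _ DM; rewrite DM; auto.
  by rewrite Dx // eqxx mulr1 (Ac i).2 ?mul0r ?addr0; auto.
rewrite Dx // (Ac j).2 ?mul0r ?addr0; auto.
by rewrite (_ : (i == j :> nat) = false) ?mulr0 // eq_sym; apply: negbTE.
Qed.

(** Gram-Schmidt: subtracting from [D0] its expansion gives [D1], which kills all [x j] but not some
    [z]. Scaling gives [D2] with value 1 at [z], and the old [D i] are corrected by multiples of
    [D2] to kill [z]. *)
Lemma dual_system_extend r (D : nat -> K -> K) (x : nat -> K) D0 : dual_system r D x -> L D0 ->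
  D0 <> (fun y => \sum_(i < r) D0 (x i) * D i y) ->
  exists (D' : nat -> K -> K) (x' : nat -> K), dual_system r.+1 D' x'.
Proof.
move=> [LD Ex Dx] L0 D0E.
have ED D1 y : L D1 -> E y -> E (D1 y) by move/pLie_der => [_ + _ _]; apply.
pose D1 y := D0 y - \sum_(i < r) D0 (x i) * D i y.
have L1 : L D1 by apply: (@pLie_sub_sum D0 r (fun i => D0 (x i)) D) => // i ir; apply: ED; auto.
have D1x j : (j < r)%N -> D1 (x j) = 0.
  move=> jr; rewrite /D1 (bigD1 (Ordinal jr)) //= big1 => [|i ij].
    by rewrite Dx // eqxx mulr1 addr0 subrr.
  by rewrite Dx // (_ : (i == j :> nat) = false) ?mulr0 //; apply: negPf.
have [z D1z] : exists z, D1 z <> 0.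
  apply: contrapT => /forallNP D1z; apply: D0E; apply/funext=> y.
  by apply/eqP; rewrite -subr_eq0; apply/eqP; apply: (contrapT (D1z y)).
have Ez : E z.
  by apply: contrapT => nz; apply: D1z; case: (pLie_der L1) => + _ _ _; apply.
pose D2 y := (D1 z)^-1 * D1 y.
have L2 : L D2.
  by apply: pLie_scale => //; case: (HE) => _ _ _ _ EV; apply/EV/ED.
have D2z : D2 z = 1 by rewrite /D2 mulVf //; apply/eqP.
have D2x j : (j < r)%N -> D2 (x j) = 0 by move=> jr; rewrite /D2 D1x ?mulr0.
exists (fun i => if i == r then D2 else fun y => D i y + (- D i z) * D2 y).
exists (fun i => if i == r then z else x i).
have lt i : (i < r.+1)%N -> (i == r) = false -> (i < r)%N.
  by rewrite ltnS leq_eqVlt => /orP[->|].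
split=> [i /lt ir|i /lt ir|i j /lt ir /lt jr].
- case: eqP ir => // _ ir; apply: pLie_addZ; auto.
  by apply: subfieldN => //; apply: ED; auto.
- by case: eqP ir => // _ ir; auto.
case: eqP ir => [-> _|nir /(_ erefl) ir]; case: eqP jr => [-> _|njr /(_ erefl) jr].
- by rewrite D2z eqxx.
- by rewrite D2x // eq_sym; case: eqP.
- by rewrite D2z mulr1 subrr; case: eqP.
- by rewrite D2x // mulr0 addr0 Dx.
Qed.

End pLieClosure.
End Jacobson.

(** * Consequences of a maximal dual system, with maximality in the form [expand] *)

Section DualBasis.
Variables (K : fieldType) (p : nat).
Hypothesis hp : p \in [pchar K].
Variables (E : K -> Prop) (L : (K -> K) -> Prop).
Hypotheses (HE : subfield E) (HL : pLie p E L).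
Variables (r : nat) (D : nat -> K -> K) (x : nat -> K).
Hypothesis HDx : dual_system E L r D x.
Hypothesis expand : forall D0, L D0 -> D0 = (fun y => \sum_(i < r) D0 (x i) * D i y).

Let LD i : (i < r)%N -> L (D i). Proof. by case: HDx => + _ _; apply. Qed.
Let Ex i : (i < r)%N -> E (x i). Proof. by case: HDx => _ + _; apply. Qed.
Let Dx i j : (i < r)%N -> (j < r)%N -> D i (x j) = (i == j)%:R.
Proof. by case: HDx => _ _; apply. Qed.
Let HD i : (i < r)%N -> derOn E (D i).
Proof. by move=> ir; apply/isDer_derOn/(pLie_der HL)/LD. Qed.

(** Elements of [L] are determined by their values at the [x i]; the identities between operators
    below are checked there. *)
Lemma dual_basis_eq0 D0 : L D0 -> (forall i, (i < r)%N -> D0 (x i) = 0) ->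
  forall y, D0 y = 0.
Proof.
move=> L0 D0x y; rewrite (expand L0) big1 // => i _.
by rewrite D0x ?mul0r.
Qed.

Lemma dual_basis_comm i j y : (i < r)%N -> (j < r)%N -> D i (D j y) = D j (D i y).
Proof.
move=> ir jr; apply/eqP; rewrite -subr_eq0; apply/eqP.
have LC : L (fun y => D i (D j y) - D j (D i y)).
  by case: HL => _ [_ [_ [_ [+ _]]]]; apply; apply: LD.
apply: (dual_basis_eq0 LC) => k kr; rewrite !Dx //.
have dn a (b : bool) : (a < r)%N -> D a b%:R = 0.
  by move=> ar; case: b; [apply: (der1 HE (HD ar)) | apply: (der0 HE (HD ar))].
by rewrite !dn // subrr.
Qed.

Lemma dual_basis_nil i y : (i < r)%N -> iter p (D i) y = 0.
Proof.
move=> ir; have LI : L (iter p (D i)).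
  by case: HL => _ [_ [_ [_ [_ +]]]]; apply; apply: LD.
(* Since [p] is at least 2, [D i] is applied at least once to the constant [D i (x k)], which is 0
   or 1. *)
apply: (dual_basis_eq0 LI) => k kr; have := prime_gt1 (pcharf_prime hp).
case: (p) => [|[|n]] // _; rewrite !iterSr Dx //.
have -> : D i (i == k)%:R = 0.
  by case: (i == k); [apply: (der1 HE (HD ir)) | apply: (der0 HE (HD ir))].
by elim: n => //= n ->; apply: (der0 HE (HD ir)).
Qed.

(** A chain of subfields descending from [E] for [k = 0] to the annihilator for [k = r]; each step
    will have degree [p]. *)
Definition common_kernel k y := E y /\ forall i, (i < k)%N -> D i y = 0.

Lemma common_kernelS k y :
  common_kernel k.+1 y <-> common_kernel k y /\ D k y = 0.
Proof.
split=> [[Ey Dy]|[[Ey Dy] Dky]].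
  by split; [split=> // i ik; apply: Dy; apply: ltnW | apply: Dy].
by split=> // i; rewrite ltnS leq_eqVlt => /predU1P[->|/Dy].
Qed.

(** Because the [D i] commute, [D k] restricts to a derivation of the [k]-th field, and the next
    field is its kernel there. *)
Lemma common_kernel_subfield k : (k <= r)%N -> subfield (common_kernel k).
Proof.
elim: k => [_|k IH kr].
  have -> // : common_kernel 0 = E.
  by apply/funext=> y; apply/propext; split=> [[]|].
rewrite (_ : common_kernel k.+1 = fun y => common_kernel k y /\ D k y = 0).
  apply: der_kernel_subfield; first exact/IH/ltnW.
  case: (HD kr) => EDk DD DM; split=> [y [Ey Dy]|y z [Ey _] [Ez _]|y z [Ey _] [Ez _]]; auto.
  split=> [|i ik]; first exact: EDk.
  by rewrite dual_basis_comm ?(ltn_trans ik) // Dy // (der0 HE (HD kr)).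
by apply/funext=> y; apply/propext/common_kernelS.
Qed.

Lemma common_kernel_derOn k : (k < r)%N -> derOn (common_kernel k) (D k).
Proof.
move=> kr; case: (HD kr) => EDk DD DM.
split=> [y [Ey Dy]|y z [Ey _] [Ez _]|y z [Ey _] [Ez _]]; auto.
split=> [|i ik]; first exact: EDk.
by rewrite dual_basis_comm ?(ltn_trans ik) // Dy // (der0 HE (HD kr)).
Qed.

Lemma common_kernel_x k : (k < r)%N -> common_kernel k (x k).
Proof.
move=> kr; split; first exact: Ex.
by move=> i ik; rewrite Dx ?(ltn_trans ik) // ltn_eqF.
Qed.

(** The Taylor expansion along [x k] has its coefficients in the kernel of [D k], that is, in the
    next field of the chain. *)
Lemma common_kernel_adjoin k : (k < r)%N ->
  common_kernel k = adjoin (common_kernel k.+1) (x k).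
Proof.
move=> kr; have HEk := common_kernel_subfield (ltnW kr).
have Hd := common_kernel_derOn kr; have xk := common_kernel_x kr.
apply/funext=> y; apply/propext; split.
  move=> Eky.
  have Dxk : D k (x k) = 1 by rewrite Dx // eqxx.
  have Dp z : common_kernel k z -> iter p (D k) z = 0 by move=> _; apply: dual_basis_nil.
  have [q [Hq _ ->]] := der_nilpotent_horner HEk Hd hp xk Dxk Dp Eky.
  by exists q => // i; apply/common_kernelS.
by apply: adjoin_sub => // z /common_kernelS[].
Qed.

Lemma common_kernel_dim k : (k < r)%N ->
  field_dim (common_kernel k.+1) (common_kernel k) p.
Proof.
move=> kr; rewrite (common_kernel_adjoin kr).
have HEk := common_kernel_subfield (ltnW kr).
have Hd := common_kernel_derOn kr; have xk := common_kernel_x kr.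
apply: (field_dim_adjoin hp); first exact: common_kernel_subfield.
  (* [x k] is outside the smaller field because [D k] sends it to 1; its [p]-th power is inside
     because [D k] sends it to a multiple of [p]. *)
  by move=> /common_kernelS[_]; rewrite Dx // eqxx; apply/eqP/oner_neq0.
apply/common_kernelS; split; first exact: subfieldX.
by rewrite (derX HEk Hd) // -mulr_natr (pcharf0 hp) mulr0.
Qed.

Lemma common_kernel_Ann : common_kernel r = Ann E L.
Proof.
apply/funext=> y; apply/propext; split=> [[Ey Dy]|[Ey Dy]]; split=> //; last by auto.
by move=> D0 L0; rewrite (expand L0) big1 // => i _; rewrite Dy ?mulr0.
Qed.

Lemma dual_basis_field_dim : field_dim (Ann E L) E (p ^ r).
Proof.
(* The chain is climbed from the annihilator upwards, hence the index [r - m]. *)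
have H m : (m <= r)%N -> field_dim (common_kernel r) (common_kernel (r - m)) (p ^ m).
  elim: m => [_|m IH mr].
    by rewrite subn0 expn0; apply/field_dim_refl/common_kernel_subfield.
  have rm : (r - m.+1 < r)%N by rewrite ltn_subrL /= (leq_trans _ mr).
  rewrite expnSr; apply: field_dim_mul (IH (ltnW mr)) _.
  - exact/common_kernel_subfield/leq_subr.
  - exact/common_kernel_subfield/leq_subr.
  - move=> y [Ey Dy]; split=> // i ir; apply: Dy; exact: leq_trans ir (leq_subr _ _).
  - by move=> y; rewrite -(subnSK mr) => /common_kernelS[].
  by rewrite -(subnSK mr); apply: common_kernel_dim.
have := H r (leqnn r); rewrite subnn common_kernel_Ann.
have -> // : common_kernel 0 = E.
by apply/funext=> y; apply/propext; split=> [[]|].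
Qed.

Lemma dual_basis_der_dim : der_dim E L r.
Proof.
exists (fun i : 'I_r => D i); split=> [i|c Ec c0 j|D0 L0]; first exact: LD.
  have := congr1 (fun f => f (x j)) c0; rewrite (bigD1 j) //= big1 => [|i ij].
    by rewrite Dx // eqxx mulr1 addr0.
  by rewrite Dx // (_ : (i == j :> nat) = false) ?mulr0 //; apply: negbTE.
exists (fun i : 'I_r => D0 (x i)); split; last exact: expand.
by move=> i; case: (pLie_der HL L0) => _ + _ _; apply; apply: Ex.
Qed.

(** [D0] minus its expansion kills the annihilator and every [x j]. Since these generate the chain
    step by step, it kills [E], so [D0] equals its expansion, which lies in [L]. *)
Lemma dual_basis_Tder D0 : Tder E (Ann E L) D0 -> L D0.
Proof.
move=> T0; have HT := Tder_pLie hp (Ann E L) HE.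
have LT D1 : L D1 -> Tder E (Ann E L) D1.
  by move=> L1; split=> [|y [_]]; [apply: (pLie_der HL) | apply].
have ED0 y : E y -> E (D0 y) by case: T0 => [[_ + _ _] _]; apply.
pose D1 y := D0 y - \sum_(i < r) D0 (x i) * D i y.
have T1 : Tder E (Ann E L) D1.
  (* The closure property is applied to the algebra of all derivations over the annihilator, as [D0]
     is not yet known to lie in [L]. *)
  by apply: (@pLie_sub_sum _ _ _ _ HE HT D0 r (fun i => D0 (x i)) D) => // i ir; auto.
have D1x j : (j < r)%N -> D1 (x j) = 0.
  move=> jr; rewrite /D1 (bigD1 (Ordinal jr)) //= big1 => [|i ij].
    by rewrite Dx // eqxx mulr1 addr0 subrr.
  by rewrite Dx // (_ : (i == j :> nat) = false) ?mulr0 //; apply: negPf.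
have H1 := isDer_derOn T1.1; have HK := der_kernel_subfield HE H1.
have D1E m : (m <= r)%N -> forall y, common_kernel (r - m) y -> E y /\ D1 y = 0.
  elim: m => [_|m IH mr] y.
    by rewrite subn0 common_kernel_Ann => Ay; split; [case: Ay | apply: T1.2].
  have rm : (r - m.+1 < r)%N by rewrite ltn_subrL /= (leq_trans _ mr).
  rewrite (common_kernel_adjoin rm) (subnSK mr).
  apply: (adjoin_sub HK); first exact/IH/ltnW.
  by split; [apply: Ex | apply: D1x].
have D10 y : D1 y = 0.
  have [Ey|nEy] := EM (E y); last by case: T1 => [[+ _ _ _] _]; apply.
  by apply: (D1E r (leqnn r) y _).2; rewrite subnn; split.
rewrite (_ : D0 = fun y => \sum_(i < r) D0 (x i) * D i y).
  by apply: (@pLie_sum _ _ _ _ HL r (fun i => D0 (x i)) D) => // i ir; auto.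
by apply/funext=> y; apply/eqP; rewrite -subr_eq0; apply/eqP/D10.
Qed.

End DualBasis.

(** * Jacobson's correspondence for one layer *)

Section Main.
Variables (K : fieldType) (p : nat).
Hypothesis hp : p \in [pchar K].

Theorem jacobson_correspondence (E : K -> Prop) (L : (K -> K) -> Prop) N
    (b : 'I_N -> K) :
  subfield E -> pLie p E L -> spans (Ann E L) (fun _ => True) b ->
  [/\ Tder E (Ann E L) = L &
      exists d, der_dim E L d /\ field_dim (Ann E L) E (p ^ d)].
Proof.
move=> HE HL sb.
pose P r := exists (D : nat -> K -> K) (x : nat -> K), dual_system E L r D x.
have [||r [D [x HDx]] max] := @max_nat_prop P N.
- by exists 0%N, (fun _ _ => 0), (fun _ => 0).
- move=> r [D [x HDx]]; apply: (free_leq_spans _ sb _ (dual_system_free HE HL HDx)) => //.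
  exact: Ann_subfield HE (pLie_der HL).
(* A [D0] that differs from its expansion would extend the maximal dual system. *)
have expand D0 : L D0 -> D0 = fun y => \sum_(i < r) D0 (x i) * D i y.
  move=> L0; apply: contrapT => D0E; apply: max.
  exact: (dual_system_extend HE HL HDx L0 D0E).
split; last first.
  exists r; split; first exact: (dual_basis_der_dim HL HDx expand).
  exact: (dual_basis_field_dim hp HE HL HDx expand).
apply/funext=> D0; apply/propext; split; first exact: (dual_basis_Tder hp HE HL HDx expand).
by move=> L0; split=> [|y [_]]; [apply: (pLie_der HL) | apply].
Qed.

End Main.

(** * Composita *)

Section Compositum.
Variable K : fieldType.
Implicit Types A B F : K -> Prop.

Lemma compositum_l A B x : A x -> compositum A B x.
Proof. by move=> Ax F _ ABF; apply: ABF; left. Qed.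

Lemma compositum_r A B x : B x -> compositum A B x.
Proof. by move=> Bx F _ ABF; apply: ABF; right. Qed.

Lemma compositum_min A B F : subfield F -> (forall x, A x -> F x) ->
  (forall x, B x -> F x) -> forall x, compositum A B x -> F x.
Proof. by move=> HF AF BF x ABx; apply: ABx => // y [/AF|/BF]. Qed.

Lemma compositum_subfield A B : subfield (compositum A B).
Proof. exact: gen_field_subfield. Qed.

Lemma spansW A B V n (b : 'I_n -> K) : (forall x, A x -> B x) ->
  spans A V b -> spans B V b.
Proof.
by move=> AB sb v /sb[c [Ac ->]]; exists c; split=> // i; apply: AB.
Qed.

End Compositum.

(** * From power towers to Jacobson sequences *)

Section Towers.
Variables (K : fieldType) (p : nat).
Hypothesis hp : p \in [pchar K].
Hypothesis hfg : fin_gen_over (Kpinf (K := K) p).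

Lemma finite_over_Kpow (A : K -> Prop) n : (forall x, Kpow p n x -> A x) ->
  exists N (b : 'I_N -> K), spans A (fun _ => True) b.
Proof.
move=> KA; have [N [b sb]] := fin_gen_spans hp n hfg.
by exists N, b; apply: spansW sb.
Qed.

Lemma Kpow0 x : Kpow (K := K) p 0 x.
Proof. by exists x; rewrite expn0 expr1. Qed.

Lemma Kpow_leq m n : (m <= n)%N -> forall x : K, Kpow p n x -> Kpow p m x.
Proof.
by move=> mn _ [x ->]; exists (x ^+ (p ^ (n - m))); rewrite -exprM -expnD subnK.
Qed.

Section PowerTower.
Variable W : nat -> K -> Prop.
Hypothesis HW : power_tower p W.

Let sW i : subfield (W i). Proof. exact: HW.1. Qed.
Let WE i j : (j <= i)%N -> W j = compositum (W i) (Kpow p j).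
Proof. exact: HW.2. Qed.

Lemma tower0 : W 0 = fun _ => True.
Proof.
apply/funext=> x; apply/propext; split=> // _.
by rewrite (WE (leqnn 0)); apply: compositum_r (Kpow0 x).
Qed.

Lemma tower_Kpow i x : Kpow p i x -> W i x.
Proof. by move=> Kx; rewrite (WE (leqnn i)); apply: compositum_r. Qed.

Lemma towerS_sub i x : W i.+1 x -> W i x.
Proof. by move=> Wx; rewrite (WE (leqnSn i)); apply: compositum_l. Qed.

(** $W_i$ is generated by $W_{i+1}$ and $K^{p^i}$; Frobenius keeps the former in $W_{i+1}$ and maps
    the latter into $K^{p^{i+1}}$, which $W_{i+1}$ contains. *)
Lemma tower_pow i x : W i x -> W i.+1 (x ^+ p).
Proof.
have pn : [pchar K].-nat p by have := pchar_natX hp 1; rewrite expn1.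
rewrite (WE (leqnSn i)); move: x; apply: compositum_min.
- exact: subfield_pow_preim.
- by move=> x; apply: subfieldX.
by move=> _ [x ->]; apply: tower_Kpow; exists x; rewrite -exprM expnSr.
Qed.

Lemma tower_Ann i : Ann (W i) (Tder (W i) (W i.+1)) = W i.+1.
Proof.
apply/funext=> x; apply/propext; split=> [[Wx Dx]|Wx]; last first.
  by split=> [|D [_]]; [apply: towerS_sub | apply].
apply: contrapT => nx; have [N [b sb]] := finite_over_Kpow (@tower_Kpow i.+1).
have [D TD D1] := Tder_separates hp (sW i) (sW i.+1) (@towerS_sub i)
  (@tower_pow i) sb Wx nx.
by move/eqP: D1; rewrite Dx // eq_sym oner_eq0.
Qed.

Lemma annseq_tower : annseq (tower_to_jac W) = W.
Proof.
apply/funext; elim=> [|i IH]; first by rewrite tower0.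
by rewrite /= IH; apply: tower_Ann.
Qed.

(** For the intersection condition: a derivation of $W_{i+1}$ killing both $W_{i+2}$ and
    $K^{p^{i+1}}$ kills their compositum, which is $W_{i+1}$ itself. *)
Lemma tower_jacobson_seq : jacobson_seq p (tower_to_jac W).
Proof.
split.
  by rewrite -tower0; apply: Tder_pLie.
move=> i; have -> : Ann (annseq (tower_to_jac W) i) (tower_to_jac W i) = W i.+1.
  by rewrite annseq_tower; apply: tower_Ann.
split; first exact: Tder_pLie.
move=> D [HD D0] [_ KD]; apply/funext=> x.
have HK := der_kernel_subfield (sW i.+1) (isDer_derOn HD).
have [Wx|nWx] := EM (W i.+1 x); last by case: HD => + _ _ _; apply.
suff [] : W i.+1 x /\ D x = 0 by [].
move: x Wx; rewrite {1}(WE (leqnSn i.+1)); apply: (compositum_min HK).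
  by move=> x Wx; split; [apply: towerS_sub | apply: D0].
by move=> x Kx; split; [apply: tower_Kpow | apply: KD].
Qed.

Lemma tower_dims i : exists d, der_dim (W i) (tower_to_jac W i) d /\
  field_dim (W i.+1) (W i) (p ^ d).
Proof.
have [N [b sb]] := finite_over_Kpow (@tower_Kpow i.+1).
rewrite -tower_Ann in sb *.
by have [] := jacobson_correspondence hp (sW i) (Tder_pLie hp _ (sW i)) sb.
Qed.

Lemma tower_jac_len n : tower_len_le W n -> jac_len_le (tower_to_jac W) n.
Proof.
move=> Wn N nN; apply/funext=> D; apply/propext.
(* Both fields of the layer coincide, so only the zero derivation remains. *)
rewrite /tower_to_jac (Wn N.+1 (leqW nN)) -(Wn N nN); split=> [[HD D0]|->].
  apply/funext=> x; have [Wx|nWx] := EM (W N x); first exact: D0.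
  by case: HD => + _ _ _; apply.
by case: (Tder_pLie hp (W N) (sW N)) => _ [].
Qed.

End PowerTower.

(** * From Jacobson sequences to power towers *)

Section JacobsonSeq.
Variable J : nat -> (K -> K) -> Prop.
Hypothesis HJ : jacobson_seq p J.
Let W := annseq J.

(** Proved jointly: the annihilator is a subfield because [J i] consists of derivations of the
    previous one. *)
Lemma annseq_subfield i : subfield (W i) /\ pLie p (W i) (J i).
Proof.
elim: i => [|i [sWi Li]]; first by split; [split | exact: HJ.1].
split; first by apply: Ann_subfield => //; apply: (pLie_der Li).
exact: (HJ.2 i).1.
Qed.
Let sW i : subfield (W i). Proof. exact: (annseq_subfield i).1. Qed.
Let LJ i : pLie p (W i) (J i). Proof. exact: (annseq_subfield i).2. Qed.

Lemma annseq_pow i x : W i x -> W i.+1 (x ^+ p).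
Proof.
move=> Wx; split; first exact: subfieldX.
move=> D JD; rewrite (derX (sW i) (isDer_derOn (pLie_der (LJ i) JD))) //.
by rewrite -mulr_natr (pcharf0 hp) mulr0.
Qed.

Lemma annseq_Kpow i x : Kpow p i x -> W i x.
Proof.
elim: i x => // i IH _ [x ->]; rewrite expnSr exprM; apply: annseq_pow.
by apply: IH; exists x.
Qed.

Lemma annseq_Tder i : Tder (W i) (W i.+1) = J i.
Proof.
have [N [b sb]] := finite_over_Kpow (@annseq_Kpow i.+1).
by have [] := jacobson_correspondence hp (sW i) (LJ i) sb.
Qed.

(** An element of $W_i$ outside the compositum would be separated from it by a derivation. Killing
    $W_{i+1}$, this derivation lies in [J i] by Jacobson's correspondence; killing $K^{p^i}$ as
    well, it is zero by the intersection condition. *)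
Lemma annseq_compositumS i : W i = compositum (W i.+1) (Kpow p i).
Proof.
have AW x : compositum (W i.+1) (Kpow p i) x -> W i x.
  apply: (compositum_min (sW i)); first by move=> y [].
  exact: annseq_Kpow.
apply/funext=> x; apply/propext; split=> [Wx|]; last exact: AW.
(* For [i = 0] the compositum contains $K^{p^0} = K$; the intersection condition starts at index
   1. *)
case: i => [|i] in Wx AW *; first exact: compositum_r (Kpow0 x).
apply: contrapT => nx.
have [N [b sb]] := finite_over_Kpow (@annseq_Kpow i.+2).
have sb' := spansW (compositum_l (B := Kpow p i.+1)) sb.
have Wp y : W i.+1 y -> compositum (W i.+2) (Kpow p i.+1) (y ^+ p).
  by move=> Wy; exact: compositum_l (annseq_pow Wy).
have [D [HD AD] Dx] :=
  Tder_separates hp (sW i.+1) (compositum_subfield _ _) AW Wp sb' Wx nx.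
have JD : J i.+1 D.
  by rewrite -annseq_Tder; split=> // y Wy; apply: AD (compositum_l Wy).
have D0 : D = fun _ => 0.
  by apply: (HJ.2 i).2 => //; split=> // y Ky; apply: AD (compositum_r Ky).
by move/eqP: Dx; rewrite D0 eq_sym oner_eq0.
Qed.

(** Telescoping of the one-step identity: $W_{j+k} = W_{j+k+1} \cdot K^{p^{j+k}}$, and the second
    factor is absorbed by $K^{p^j}$. *)
Lemma annseq_power_tower : power_tower p W.
Proof.
split=> // i j ji; rewrite -(subnKC ji); elim: (i - j)%N => [|k IH].
  rewrite addn0; apply/funext=> x; apply/propext; split; first exact: compositum_l.
  by apply: (compositum_min (sW j)) => //; apply: annseq_Kpow.
apply/funext=> x; apply/propext; split; last first.
  apply: (compositum_min (sW j)); last exact: annseq_Kpow.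
  move=> y; rewrite addnS => -[Wy _]; rewrite IH; exact: compositum_l.
rewrite IH; apply: (compositum_min (compositum_subfield _ _)); last first.
  by move=> y; apply: compositum_r.
rewrite annseq_compositumS addnS.
apply: (compositum_min (compositum_subfield _ _)); first by move=> y; apply: compositum_l.
by move=> y Ky; apply: compositum_r; apply: Kpow_leq Ky; apply: leq_addr.
Qed.

End JacobsonSeq.

Lemma jac_tower_len (J : nat -> (K -> K) -> Prop) n :
  jac_len_le J n -> tower_len_le (jac_to_tower J) n.
Proof.
move=> Jn N nN; rewrite -(subnKC nN) /jac_to_tower.
elim: (N - n)%N => [|k IH]; first by rewrite addn0.
rewrite addnS /= -IH (Jn (n + k)%N (leq_addr _ _)).
by apply/funext=> x; apply/propext; split=> [[]|Wx] //; split=> // D ->.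
Qed.

End Towers.

(** * The bijection, its restrictions by length, and the dimension formula *)

Theorem mainTheorem4 (K : fieldType) (p : nat) (hp : p \in [pchar K])
  (hfg : fin_gen_over (Kpinf (K := K) p)) :
  (* the two maps land in the right sets and are mutually inverse *)
  (forall W : nat -> K -> Prop, power_tower p W -> jacobson_seq p (tower_to_jac W)) /\
  (forall J : nat -> (K -> K) -> Prop, jacobson_seq p J -> power_tower p (jac_to_tower J)) /\
  (forall W : nat -> K -> Prop, power_tower p W -> jac_to_tower (tower_to_jac W) = W) /\
  (forall J : nat -> (K -> K) -> Prop, jacobson_seq p J -> tower_to_jac (jac_to_tower J) = J) /\
  (* restriction to length at most n *)
  (forall (n : nat) (W : nat -> K -> Prop), power_tower p W ->
      tower_len_le W n -> jac_len_le (tower_to_jac W) n) /\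
  (forall (n : nat) (J : nat -> (K -> K) -> Prop), jacobson_seq p J ->
      jac_len_le J n -> tower_len_le (jac_to_tower J) n) /\
  (* dimension formula: F_m = tower_to_jac W (m-1) *)
  (forall W : nat -> K -> Prop, power_tower p W -> forall m : nat, (0 < m)%N ->
      exists d : nat, der_dim (W m.-1) (tower_to_jac W m.-1) d /\
                      field_dim (W m) (W m.-1) (p ^ d)).
Proof.
split; first exact: tower_jacobson_seq.
split; first exact: annseq_power_tower.
split; first exact: annseq_tower.
split; first by move=> J HJ; apply/funext=> i; exact: (annseq_Tder hp hfg HJ).
split; first by move=> n W HW; exact: (tower_jac_len hp HW).
split; first by move=> n J _; apply: jac_tower_len.
by move=> W HW [//|m] _; apply: tower_dims.
Qed.
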